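(* Let $n\ge 0$ be an even integer, let $N$ be an odd integer with $n+2<N$, and let $g=\gcd(N,n+2)$. For real $\lambda$ let $$H=\sum_{j=1}^N\sigma_j^x\sigma_{j+1}^x+\lambda\sum_{j=1}^N\sigma_j^y\left(\sigma_{j+1}^z\sigma_{j+2}^z\cdots\sigma_{j+n}^z\right)\sigma_{j+n+1}^y$$ be the $n$-Cluster-Ising Hamiltonian on $(\mathbb C^2)^{\otimes N}$ with periodic boundary conditions. Then the eigenspace of $H$ for its smallest eigenvalue has dimension $4g$ if $\lambda\in(0,1)$, and dimension $2g$ if $\lambda\in(-1,0)$.
   Context: $\sigma_j^\alpha$, $\alpha\in\{x,y,z\}$, denotes the Pauli matrix $\sigma^\alpha$ acting on the $j$-th tensor factor of $(\mathbb C^2)^{\otimes N}$, with periodic indices $\sigma^\alpha_{j+N}=\sigma^\alpha_j$. For $n=0$ the product of $\sigma^z$ operators is empty and the second term is $\lambda\sum_j\sigma_j^y\sigma_{j+1}^y$. *)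

(* Defs.v *)
From HB Require Import structures.
From mathcomp Require Import all_boot all_order all_algebra.
From mathcomp Require Import complex.
From mathcomp Require Import reals.

Set Implicit Arguments.
Unset Strict Implicit.
Unset Printing Implicit Defensive.

Import GRing.Theory.

Local Open Scope ring_scope.
Local Open Scope complex_scope.

Definition mx22 (C : nzRingType) (a b c d : C) : 'M[C]_2 :=
  \matrix_(i, j) if i == 0 then (if j == 0 then a else b)
                 else (if j == 0 then c else d).

Definition pauli_x (R : realType) : 'M[R[i]]_2 := mx22 0 1 1 0.
Definition pauli_y (R : realType) : 'M[R[i]]_2 := mx22 0 (- 'i) 'i 0.
Definition pauli_z (R : realType) : 'M[R[i]]_2 := mx22 1 0 0 (- 1).

Notation spin_config N := {ffun 'I_N -> 'I_2}.

(* (C^2)^{(x) N} in coordinates: psi s is the coefficient of psi on the tensor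
   e_{s 0} (x) ... (x) e_{s (N - 1)} of standard basis vectors of C^2. *)
Notation spin_space R N := {ffun spin_config N -> (R[i])^o}.

Definition set_spin (N : nat) (s : spin_config N) (j : 'I_N) (b : 'I_2) :
    spin_config N :=
  [ffun k => if k == j then b else s k].

(* Coordinates of (1 (x) ... (x) A (x) ... (x) 1) psi, A in position j. *)
Definition site_fun (R : realType) (N : nat) (A : 'M[R[i]]_2) (j : 'I_N)
    (psi : spin_space R N) : spin_space R N :=
  [ffun s : spin_config N => \sum_(b < 2) A (s j) b * psi (set_spin s j b)].

Definition site_op (R : realType) (N : nat) (A : 'M[R[i]]_2) (j : 'I_N) :
    'End(spin_space R N) :=
  linfun (site_fun A j).

(* linfun f is only meaningful for linear f. *)
Fact site_fun_is_linear (R : realType) (N : nat) (A : 'M[R[i]]_2) (j : 'I_N) :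
  linear (site_fun A j : spin_space R N -> spin_space R N).
Proof.
move=> a u v; apply/ffunP => s; rewrite !ffunE scaler_sumr -big_split /=.
by apply: eq_bigr => b _; rewrite !ffunE mulrDr; congr (_ + _); rewrite mulrCA.
Qed.

HB.instance Definition _ (R : realType) (N : nat) (A : 'M[R[i]]_2) (j : 'I_N) :=
  GRing.isLinear.Build R[i] (spin_space R N) (spin_space R N) *:%R
    (site_fun A j) (site_fun_is_linear A j).

Fact site_opE (R : realType) (N : nat) (A : 'M[R[i]]_2) (j : 'I_N) :
  site_op A j =1 site_fun A j.
Proof. exact: lfunE. Qed.

(* Sites are numbered from 0; ordS is the cyclic successor, so this is the
   site j + k with periodic boundary conditions. *)
Definition site_shift (N : nat) (j : 'I_N) (k : nat) : 'I_N :=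
  iter k (@ordS N) j.

Fact site_shiftE (N : nat) (j : 'I_N) (k : nat) :
  site_shift j k = ((j + k) %% N)%N :> nat.
Proof.
elim: k => [|k IHk]; first by rewrite addn0 modn_small.
by rewrite /site_shift iterS /= -/(site_shift j k) IHk -addn1 modnDml addn1 addnS.
Qed.

Definition z_string (R : realType) (N n : nat) (j : 'I_N) :
    'End(spin_space R N) :=
  \big[@comp_lfun _ _ _ _/ \1%VF]_(1 <= k < n.+1)
    site_op (pauli_z R) (site_shift j k).

Definition cluster_ising (R : realType) (N n : nat) (lambda : R) :
    'End(spin_space R N) :=
  \sum_(j < N) (site_op (pauli_x R) j
                \o site_op (pauli_x R) (site_shift j 1))%VF
  + lambda%:C *:
    \sum_(j < N) (site_op (pauli_y R) j \o z_string R n j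
                  \o site_op (pauli_y R) (site_shift j n.+1))%VF.

(* In R[i], x <= y means that y - x is a nonnegative real, so this also says
   that all the eigenvalues of f are real. *)
Definition is_smallest_eigenvalue (R : realType) (vT : vectType R[i])
    (f : 'End(vT)) (E : R) : Prop :=
  passmx.leigenvalue f E%:C /\ forall z : R[i], passmx.leigenvalue f z -> E%:C <= z.

(* Main.v *)
Require Import Defs.
From HB Require Import structures.
From mathcomp Require Import all_boot all_order all_algebra.
From mathcomp Require Import cyclic separable cyclotomic.
From mathcomp Require Import ring lra zify.
From mathcomp Require Import complex.
From mathcomp Require Import reals.

Set Implicit Arguments.
Unset Strict Implicit.
Unset Printing Implicit Defensive.

Import Order.TTheory GRing.Theory Num.Theory.

Local Open Scope ring_scope.
Local Open Scope complex_scope.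

(** On a ring of odd length N, exactly one of d and - d is odd for every
    nonzero displacement d. Attaching to the flip at site j the sigma^z at the
    sites j + d, d even and nonzero, gives 2N Majorana operators A_j, B_j that
    are translation covariant, so that no boundary term appears as it would in
    the usual Jordan-Wigner transformation: with Z the product of all sigma^z,
      H = Z * sum_j B_j (A_{j-1} + lambda A_{j+n+1})   on the whole space.
    In Fourier modes, H = Z * N^-1 sum_q c_q b_{-q} a_q, where c_q = s_q u_q,
    s_q = |1 + lambda w^(q(n+2))| and the phases satisfy u_q u_{-q} = 1, u_0 = 1.
    Such phases are absorbed by an inner automorphism commuting with Z and with
    the b_q. Thus H is similar to Z * sum_q s_q P_q, where P_q is the parity of
    the mode (a_q + b_q) / 2. These modes are Fourier transforms of local ones,
    which all annihilate the configuration 0, so the eigenvectors are indexed by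
    sets S of occupied modes, with energy (-1)^|S| sum_q s_q (-1)^[q in S].
    The empty set has energy + sum_q s_q: as N is odd, the minimum is attained
    exactly at the singletons {q} with s_q minimal and at their complements.
    The minimizers of s_q are the q with w^(q(n+2)) = 1 when lambda < 0, and
    those mapping to one of two conjugate nonreal numbers when lambda > 0; each
    fibre of q |-> w^(q(n+2)) has gcd(N, n+2) elements. *)

(** * Anticommutators with scalar values *)

Section Anticommutation.

Variables (C : fieldType) (E : algType C).
Implicit Types (x y z : E) (c : C).

Definition anticomm x y c := x * y + y * x = c%:A.

Lemma anticommC x y c : anticomm x y c -> anticomm y x c.
Proof. by rewrite /anticomm addrC. Qed.

Lemma anticommE x y c : anticomm x y c -> x * y = c%:A - y * x.
Proof. by move=> <-; rewrite addrK. Qed.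

Lemma anticomm0E x y : anticomm x y 0 -> x * y = - (y * x).
Proof. by move/anticommE->; rewrite scale0r sub0r. Qed.

Lemma anticomm0P x y : x * y = - (y * x) -> anticomm x y 0.
Proof. by rewrite /anticomm => ->; rewrite addNr scale0r. Qed.

Lemma anticommDl x x' y c c' :
  anticomm x y c -> anticomm x' y c' -> anticomm (x + x') y (c + c').
Proof.
by rewrite /anticomm => h h'; rewrite mulrDl mulrDr addrACA h h' scalerDl.
Qed.

Lemma anticommZl k x y c : anticomm x y c -> anticomm (k *: x) y (k * c).
Proof.
by rewrite /anticomm => h; rewrite -scalerAl -scalerAr -scalerDr h scalerA.
Qed.

Lemma anticommDr x y y' c c' :
  anticomm x y c -> anticomm x y' c' -> anticomm x (y + y') (c + c').
Proof. by move=> /anticommC h /anticommC h'; apply/anticommC/anticommDl. Qed.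

Lemma anticommZr k x y c : anticomm x y c -> anticomm x (k *: y) (k * c).
Proof. by move=> /anticommC h; apply/anticommC/anticommZl. Qed.

Lemma anticomm_suml (I : finType) (x : I -> E) y (c : I -> C) :
  (forall i, anticomm (x i) y (c i)) -> anticomm (\sum_i x i) y (\sum_i c i).
Proof.
move=> h; rewrite /anticomm mulr_suml mulr_sumr -big_split scaler_suml.
by apply: eq_bigr => i _; exact: h.
Qed.

Lemma anticomm_sumr (I : finType) x (y : I -> E) (c : I -> C) :
  (forall i, anticomm x (y i) (c i)) -> anticomm x (\sum_i y i) (\sum_i c i).
Proof.
by move=> h; apply/anticommC/anticomm_suml => i; apply/anticommC.
Qed.

Lemma anticomm0_commM x y z :
  anticomm x y 0 -> anticomm x z 0 -> GRing.comm x (y * z).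
Proof.
move=> /anticomm0E xy /anticomm0E xz.
by rewrite /GRing.comm mulrA xy mulNr -[y * x * z]mulrA xz mulrN opprK mulrA.
Qed.

Lemma anticomm_sqr0 x : (2 : C) != 0 -> anticomm x x 0 -> x * x = 0.
Proof.
move=> n2; rewrite /anticomm scale0r -mulr2n -scaler_nat => /eqP.
by rewrite scaler_eq0 (negPf n2) => /eqP.
Qed.

End Anticommutation.

(** * Flip and parity of fermionic modes *)

Section FermionModes.

Variables (C : fieldType) (E : algType C) (G : finType) (f g : G -> E).
Hypothesis nz2 : (2 : C) != 0.
Hypothesis ff0 : forall p q, anticomm (f p) (f q) 0.
Hypothesis gg0 : forall p q, anticomm (g p) (g q) 0.
Hypothesis fg1 : forall p q, anticomm (f p) (g q) (p == q)%:R.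

(** With [f] annihilating and [g] creating, the sum exchanges empty and occupied, while
    [f q * g q - g q * f q] is 1 - 2 g f, equal to 1 on empty and to -1 on occupied states. *)
Definition mode_flip q := f q + g q.
Definition mode_parity q := f q * g q - g q * f q.

Let fgE q : f q * g q = 1 - g q * f q.
Proof. by rewrite (anticommE (fg1 q q)) eqxx scale1r. Qed.
Let ff q : f q * f q = 0. Proof. exact: anticomm_sqr0. Qed.
Let gg q : g q * g q = 0. Proof. exact: anticomm_sqr0. Qed.
Let fgf q : f q * g q * f q = f q.
Proof. by rewrite fgE mulrBl mul1r -mulrA ff mulr0 subr0. Qed.
Let gfg q : g q * f q * g q = g q.
Proof. by rewrite -mulrA fgE mulrBr mulr1 mulrA gg mul0r subr0. Qed.

Lemma mode_flipK q : mode_flip q * mode_flip q = 1.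
Proof.
rewrite /mode_flip mulrDl !mulrDr ff gg add0r addr0.
by rewrite (fg1 q q) eqxx scale1r.
Qed.

Lemma mode_parity_flip q :
  mode_parity q * mode_flip q = - (mode_flip q * mode_parity q).
Proof.
rewrite /mode_parity /mode_flip mulrBl mulrDl !mulrDr !mulrN.
rewrite fgf gfg !mulrA fgf gfg ff gg -!mulrA ff gg !mul0r !mulr0.
by rewrite !add0r !addr0 subr0 opprD opprK addrC.
Qed.

Lemma mode_parity_flip_neq p q : p != q ->
  mode_parity p * mode_flip q = mode_flip q * mode_parity p.
Proof.
move=> npq; have Ff : anticomm (mode_flip q) (f p) 0.
  rewrite -[0]addr0; apply: anticommDl => //; apply: anticommC.
  by have := fg1 p q; rewrite (negPf npq).
have Fg : anticomm (mode_flip q) (g p) 0.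
  rewrite -[0]addr0; apply: anticommDl => //.
  by have := fg1 q p; rewrite eq_sym (negPf npq).
rewrite /mode_parity mulrBl mulrBr.
by rewrite (anticomm0_commM Ff Fg) (anticomm0_commM Fg Ff).
Qed.

End FermionModes.

(** * Fourier transform over a finite abelian group *)

Section Fourier.

Variables (C : fieldType) (E : algType C) (G : finZmodType) (e : G -> G -> C).
Hypothesis e0 : forall p, e p 0 = 1.
Hypothesis eC : forall p q, e p q = e q p.
Hypothesis eD : forall p j k, e p (j + k) = e p j * e p k.
Hypothesis e_sum : forall p, \sum_j e p j = (p == 0)%:R * #|G|%:R.

(** Not normalised: the factor [#|G|] stays in the anticommutators and is divided out in
    [creator]. *)
Definition fourier (X : G -> E) (q : G) := \sum_j e q j *: X j.

Lemma fourier_anticomm (X Y : G -> E) (c : C) :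
  (forall j k, anticomm (X j) (Y k) ((j == k)%:R * c)) ->
  forall p q, anticomm (fourier X p) (fourier Y q)
                ((p + q == 0)%:R * #|G|%:R * c).
Proof.
move=> h p q; have -> : (p + q == 0)%:R * #|G|%:R * c =
    \sum_j \sum_k e p j * (e q k * ((j == k)%:R * c)).
  rewrite -e_sum mulr_suml; apply: eq_bigr => j _.
  rewrite (bigD1 j) //= big1 ?addr0 => [|k]; last first.
    by rewrite eq_sym => /negPf->; rewrite mul0r !mulr0.
  by rewrite eqxx mul1r !(eC _ j) eD mulrA.
apply: anticomm_suml => j; apply: anticomm_sumr => k.
by rewrite mulrCA; apply: anticommZr; apply: anticommZl.
Qed.

Lemma fourier_anticomm0 (X : G -> E) (y : E) :
  (forall j, anticomm y (X j) 0) -> forall q, anticomm y (fourier X q) 0.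
Proof.
move=> h q; have -> : 0 = \sum_(j : G) e q j * 0 :> C.
  by rewrite big1 // => j _; rewrite mulr0.
by apply: anticomm_sumr => j; apply: anticommZr.
Qed.

Lemma bicharNl p j : e (- p) j = e p (- j).
Proof.
have eV : e p j * e p (- j) = 1 by rewrite -eD subrr e0.
have nz : e p j != 0 by apply: contra_eq_neq eV => ->; rewrite mul0r eq_sym oner_eq0.
by apply: (mulfI nz); rewrite eV ![e _ j]eC -eD subrr e0.
Qed.

(** Summing [e q (k - (j + r))] over q kills all pairs but k = j + r. Thus a translation invariant
    bond sum becomes diagonal in momentum. *)
Lemma convolution_fourier (X Y : G -> E) (r : G) :
  \sum_q e q (- r) *: (fourier Y (- q) * fourier X q) =
  #|G|%:R *: \sum_j Y j * X (j + r).
Proof.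
have sumE q : e q (- r) *: (fourier Y (- q) * fourier X q) =
    \sum_j \sum_k e q (k - (j + r)) *: (Y j * X k).
  rewrite /fourier mulr_suml scaler_sumr; apply: eq_bigr => j _.
  rewrite mulr_sumr scaler_sumr; apply: eq_bigr => k _.
  rewrite -scalerAl -scalerAr !scalerA opprD !eD.
  by rewrite bicharNl; congr (_ *: _); ring.
rewrite (eq_bigr _ (fun q _ => sumE q)) exchange_big scaler_sumr.
apply: eq_bigr => j _; rewrite exchange_big (bigD1 (j + r)) //= [X in _ + X]big1.
  rewrite addr0 -scaler_suml subrr.
  by rewrite (eq_bigr _ (fun q _ => eC q 0)) e_sum eqxx mul1r.
move=> k nk; rewrite -scaler_suml (eq_bigr _ (fun q _ => eC q _)) e_sum.
by rewrite subr_eq0 (negPf nk) mul0r scale0r.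
Qed.

End Fourier.

(** * Fermions and gauge transformations from Majorana operators *)

Section MajoranaModes.

Variables (C : fieldType) (E : algType C) (G : finZmodType) (e : G -> G -> C).
Hypothesis eC : forall p q, e p q = e q p.
Hypothesis eD : forall p j k, e p (j + k) = e p j * e p k.
Hypothesis e_sum : forall p, \sum_j e p j = (p == 0)%:R * #|G|%:R.
Hypothesis nz2 : (2 : C) != 0.
Hypothesis nzG : (#|G|%:R : C) != 0.
Hypothesis no2 : forall q : G, q != 0 -> q + q != 0.

Variables (A B : G -> E) (Z : E).
Hypothesis AA : forall j k, anticomm (A j) (A k) ((j == k)%:R * 2).
Hypothesis BB : forall j k, anticomm (B j) (B k) ((j == k)%:R * -2).
Hypothesis AB : forall j k, anticomm (A j) (B k) 0.
Hypothesis ZA : forall j, anticomm Z (A j) 0.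
Hypothesis ZB : forall j, anticomm Z (B j) 0.

Let a := fourier e A.
Let b := fourier e B.

Let aa p q : anticomm (a p) (a q) ((p + q == 0)%:R * #|G|%:R * 2).
Proof. exact: fourier_anticomm. Qed.

Let bb p q : anticomm (b p) (b q) ((p + q == 0)%:R * #|G|%:R * -2).
Proof. exact: fourier_anticomm. Qed.

Let ab p q : anticomm (a p) (b q) 0.
Proof.
have := @fourier_anticomm C E G e eC eD e_sum A B 0.
by move=> /(_ _ p q); rewrite mulr0; apply=> j k; rewrite mulr0.
Qed.

Let Za q : anticomm Z (a q) 0. Proof. exact: fourier_anticomm0. Qed.
Let Zb q : anticomm Z (b q) 0. Proof. exact: fourier_anticomm0. Qed.

(** The values 2 and -2 of the two kinds of Majoranas cancel between annihilators and between
    creators. The creator uses momentum - q so that it pairs with [annihilator q], and its prefactor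
    makes the pairing 1. *)
Definition annihilator q := 2^-1 *: (a q + b q).
Definition creator q := (2 * #|G|%:R)^-1 *: (a (- q) - b (- q)).

Local Notation f := annihilator.
Local Notation g := creator.

Lemma annihilator_anticomm p q : anticomm (f p) (f q) 0.
Proof.
have := anticommDl (anticommDr (aa p q) (ab p q))
  (anticommDr (anticommC (ab q p)) (bb p q)).
move/(anticommZl 2^-1)/(anticommZr 2^-1).
by congr anticomm; ring.
Qed.

Lemma creator_anticomm p q : anticomm (g p) (g q) 0.
Proof.
have := anticommDl
  (anticommDr (aa (- p) (- q)) (anticommZr (-1) (ab (- p) (- q))))
  (anticommZl (-1)
     (anticommDr (anticommC (ab (- q) (- p)))
        (anticommZr (-1) (bb (- p) (- q))))).
move/(anticommZl (2 * #|G|%:R)^-1)/(anticommZr (2 * #|G|%:R)^-1).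
by rewrite !scaleN1r; congr anticomm; ring.
Qed.

Lemma annihilator_creator p q : anticomm (f p) (g q) (p == q)%:R.
Proof.
have := anticommDl (anticommDr (aa p (- q)) (anticommZr (-1) (ab p (- q))))
  (anticommDr (anticommC (ab (- q) p)) (anticommZr (-1) (bb p (- q)))).
move/(anticommZl 2^-1)/(anticommZr (2 * #|G|%:R)^-1).
rewrite !scaleN1r subr_eq0; congr anticomm.
by case: (p == q); field; rewrite ?nzG ?nz2.
Qed.

Lemma Z_flip q : anticomm Z (mode_flip f g q) 0.
Proof.
rewrite -[0]addr0; apply: anticommDr.
  rewrite -(mulr0 2^-1); apply: anticommZr; rewrite -[0]addr0.
  exact: anticommDr.
rewrite -(mulr0 (2 * #|G|%:R)^-1); apply: anticommZr; rewrite -[0]addr0.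
apply: anticommDr => //; rewrite -scaleN1r -(mulr0 (-1)); exact: anticommZr.
Qed.

(** Expanding the parity of mode q gives commutators of [a q] with [a (- q)] and of [b q] with
    [b (- q)], odd in q and hence cancelling against the even weight s, and mixed products, which
    survive. *)
Lemma sum_mode_parity (s : G -> C) : (forall q, s (- q) = s q) ->
  \sum_q s q *: mode_parity f g q
    = #|G|%:R^-1 *: \sum_q s q *: (b (- q) * a q).
Proof.
move=> sN; pose k := (2 * 2 * #|G|%:R)^-1 : C.
pose X q := s q *: (a q * a (- q) - a (- q) * a q).
pose Y q := s q *: (b q * b (- q) - b (- q) * b q).
have odd_sum0 (x : G -> E) : (forall q, x (- q) = - x q) -> \sum_q x q = 0.
  move=> xN; have : \sum_q x q = - \sum_q x q.
    rewrite {1}(reindex_inj oppr_inj) /= -sumrN.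
    by apply: eq_bigr => q _; rewrite xN.
  move/eqP; rewrite -addr_eq0 -mulr2n -scaler_nat scaler_eq0 (negPf nz2).
  by move/eqP.
have X0 : \sum_q X q = 0.
  by apply: odd_sum0 => q; rewrite /X sN opprK -scalerN opprB.
have Y0 : \sum_q Y q = 0.
  by apply: odd_sum0 => q; rewrite /Y sN opprK -scalerN opprB.
pose M q := s q *: (b (- q) * a q).
have parityE q : s q *: mode_parity f g q =
    k *: (X q - Y q + 2 *: M q + 2 *: M (- q)).
  rewrite /mode_parity /annihilator /creator.
  rewrite -!scalerAl -!scalerAr !scalerA [_^-1 * 2^-1]mulrC -scalerBr scalerA.
  have -> : s q * (2^-1 / (2 * #|G|%:R)) = k * s q.
    by rewrite /k !invfM mulrC !mulrA.
  rewrite -scalerA; congr (_ *: _); rewrite /X /Y /M sN opprK.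
  rewrite ![2 * _]mulrC -!scalerA -scalerBr -!scalerDr; congr (_ *: _).
  rewrite !(mulrDl, mulrDr) !(mulNr, mulrN) (anticomm0E (ab q (- q))).
  rewrite (anticomm0E (ab (- q) q)) !opprK !opprD !opprK.
  rewrite ![2 *: _]scaler_nat !mulr2n.
  by rewrite [LHS](AC (2*2*(2*2)) ((1*5)*(4*8)*(2*7)*(3*6))).
rewrite (eq_bigr _ (fun q _ => parityE q)) -scaler_sumr !big_split /= sumrN.
have -> : \sum_q 2 *: M (- q) = \sum_q 2 *: M q.
  by rewrite [RHS](reindex_inj oppr_inj).
rewrite X0 Y0 subr0 add0r -scaler_sumr -scalerDl scalerA; congr (_ *: _).
have -> : 2 + 2 = 2 * 2 :> C by ring.
by rewrite /k invfM mulrAC mulVf ?mul1r // mulf_neq0.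
Qed.

(** The element [m] is idempotent with x m = x, m x = 0, m y = y and y m = 0, so 1 + (t - 1) m
    rescales [a q] and [a (- q)] inversely under conjugation. Being quadratic in these two, it
    commutes with whatever anticommutes with both. *)
Lemma gauge_step q t : q != 0 -> t != 0 -> exists r r',
  [/\ r' * r = 1, GRing.comm Z r, forall p, GRing.comm (b p) r,
      a q * r = t *: (r * a q) /\ r * a (- q) = t *: (a (- q) * r) &
      forall p, p != q -> p != - q -> GRing.comm (a p) r].
Proof.
move=> nq nt; pose x := a q; pose y := a (- q).
pose m := (2 * #|G|%:R)^-1 *: (y * x).
have xx : x * x = 0.
  apply: anticomm_sqr0 => //; have := aa q q.
  by rewrite (negPf (no2 nq)) !mul0r.
have yy : y * y = 0.
  apply: anticomm_sqr0 => //; have := aa (- q) (- q).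
  by rewrite -opprD oppr_eq0 (negPf (no2 nq)) !mul0r.
have nz2G : 2 * #|G|%:R != 0 :> C by rewrite mulf_neq0.
have xyE : x * y = (2 * #|G|%:R)%:A - y * x.
  have := anticommE (aa q (- q)); rewrite subrr eqxx mul1r => ->.
  by rewrite mulrC.
have mx : m * x = 0 by rewrite /m -scalerAl -mulrA xx mulr0 scaler0.
have ym : y * m = 0 by rewrite /m -scalerAr mulrA yy mul0r scaler0.
have xm : x * m = x.
  rewrite /m -scalerAr mulrA xyE mulrBl -mulrA xx mulr0 subr0.
  by rewrite -scalerAl mul1r scalerA mulVf ?scale1r.
have my : m * y = y.
  rewrite /m -scalerAl -mulrA xyE mulrBr mulrA yy mul0r subr0.
  by rewrite -scalerAr mulr1 scalerA mulVf ?scale1r.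
have mm : m * m = m by rewrite {1}/m -scalerAl -mulrA xm.
have comm_r z c : GRing.comm z (y * x) -> GRing.comm z (1 + c *: m).
  move=> zm; rewrite /GRing.comm mulrDr mulrDl mul1r mulr1.
  by rewrite /m -!scalerAr -!scalerAl zm.
clearbody m.
exists (1 + (t - 1) *: m), (1 + (t^-1 - 1) *: m); split.
- rewrite mulrDl mul1r mulrDr mulr1 -scalerAl -scalerAr mm scalerA.
  rewrite -addrA -!scalerDl -[RHS]addr0; congr (_ + _).
  rewrite -[RHS](scale0r m); congr (_ *: _).
  by field.
- by apply: comm_r; apply: anticomm0_commM; exact: Za.
- by move=> p; apply: comm_r; apply: anticomm0_commM; apply: anticommC; exact: ab.
- rewrite -/x -/y; split.
    rewrite mulrDr mulr1 -scalerAr xm mulrDl mul1r -scalerAl mx scaler0 addr0.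
    by rewrite -{1}[x]scale1r -scalerDl addrC subrK.
  rewrite mulrDl mul1r -scalerAl my mulrDr mulr1 -scalerAr ym scaler0 addr0.
  by rewrite -{1}[y]scale1r -scalerDl addrC subrK.
- move=> p npq npNq; apply: comm_r; apply: anticomm0_commM.
    have := aa p (- q); by rewrite subr_eq0 (negPf npq) !mul0r.
  have := aa p q; by rewrite addr_eq0 (negPf npNq) !mul0r.
Qed.

(* A momentum-dependent phase in front of the modes of A is implemented by an
   inner automorphism, because opposite momenta carry opposite phases. *)
Lemma gauge (u : G -> C) : u 0 = 1 -> (forall q, u (- q) * u q = 1) ->
  exists r r', [/\ r' * r = 1, GRing.comm Z r, forall p, GRing.comm (b p) r &
    forall p, u p *: (a p * r) = r * a p].
Proof.
move=> u0 uN.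
(* Induction on a set of momenta stable under negation, removing one pair {q, - q} at a time. *)
suff gaugeS n (S : {set G}) : (#|S| <= n)%N -> 0 \notin S ->
    (forall q, (- q \in S) = (q \in S)) -> exists r r',
    [/\ r' * r = 1, GRing.comm Z r, forall p, GRing.comm (b p) r &
      forall p, (if p \in S then u p else 1) *: (a p * r) = r * a p].
  have [||q|r [r' [h1 h2 h3 h4]]] := gaugeS #|[set~ 0 : G]| [set~ 0].
  - by [].
  - by rewrite !inE eqxx.
  - by rewrite !inE oppr_eq0.
  - exists r, r'; split => // p; have := h4 p; rewrite !inE.
    by case: eqP => //= ->; rewrite u0.
elim: n S => [|n IHn] S.
  rewrite leqn0 cards_eq0 => /eqP-> _ _; exists 1, 1; split.
  - by rewrite mulr1.
  - exact: GRing.commr1.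
  - by move=> p; exact: GRing.commr1.
  - by move=> p; rewrite inE scale1r mulr1 mul1r.
move=> cardS S0 SN; have [->|/set0Pn[q qS]] := eqVneq S set0.
  by apply: IHn; rewrite ?cards0 ?inE // => q; rewrite !inE.
have nq : q != 0 by apply: contraNneq S0 => <-.
have nqN : q != - q by rewrite -addr_eq0 no2.
have nuN : u (- q) != 0.
  by apply: contra_eq_neq (uN q) => ->; rewrite mul0r eq_sym oner_eq0.
have [|||r [r' [r'r Zr br ar]]] := IHn (S :\ q :\ - q).
- rewrite -ltnS; apply: leq_trans cardS; apply: proper_card.
  apply: (sub_proper_trans (subD1set _ _)); exact: properD1.
- by rewrite !inE (negPf S0) !andbF.
- by move=> p; rewrite !inE SN eqr_opp eqr_oppLR !andbA [(p != q) && _]andbC.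
(* The scalar [u (- q)] is the phase required at - q; at q it appears on the other side and [uN]
   cancels it. *)
have [t [t' [t't Zt bt [aqt aNqt] apt]]] := gauge_step nq nuN.
exists (r * t), (t' * r'); split.
- by rewrite mulrA -(mulrA t') r'r mulr1.
- exact: GRing.commrM.
- by move=> p; apply: GRing.commrM.
move=> p; have := ar p; rewrite !inE mulrA.
have [->|npNq] := eqVneq p (- q).
  rewrite SN qS /= scale1r => ->.
  by rewrite -mulrA -mulrA aNqt scalerAr.
have [->|npq] := eqVneq p q.
  by rewrite /= qS scale1r => ->; rewrite -!mulrA aqt -scalerAr scalerA mulrC uN scale1r.
rewrite /= => arp; rewrite scalerAl arp -!mulrA; congr (_ * _); exact: apt.
Qed.

End MajoranaModes.

(** * Endomorphisms as an algebra under composition *)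

Section EndoAlgebra.

Variables (K : fieldType) (vT : vectType K).
Hypothesis vT_proper : (0 < dim vT)%N.

(* The library's [lfun_algType] multiplies endomorphisms in the opposite
   order. *)
Definition endo_nzRing : nzRingType := lfun_comp_nzRingType vT_proper.
Definition endo_lalgMixin := GRing.Lmodule_isLalgebra.Build K endo_nzRing
  (fun k x y => comp_lfunZl k x y).
Definition endo_lalg : lalgType K :=
  HB.pack 'End(vT) endo_nzRing endo_lalgMixin.
Definition endo_algMixin := GRing.Lalgebra_isAlgebra.Build K endo_lalg
  (fun k x y => comp_lfunZr k x y).
Definition endo_alg : algType K :=
  HB.pack 'End(vT) endo_lalg endo_algMixin.

End EndoAlgebra.

(** * Eigenspace dimensions from an eigenbasis *)

Section Eigenbasis.

Variables (K : fieldType) (vT : vectType K) (I : finType).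

(** A free family of full cardinality is a basis. In its coordinates T - a is diagonal, so its
    kernel is spanned by the basis vectors of eigenvalue a. *)
Lemma eigenbasis_dim (T : 'End(vT)) (v : I -> vT) (f : I -> K) :
  (forall i, T (v i) = f i *: v i) ->
  (forall k : I -> K, \sum_i k i *: v i = 0 -> forall i, k i = 0) ->
  #|I| = \dim {:vT} ->
  forall a, \dim (passmx.leigenspace T a) = #|[set i | f i == a]|.
Proof.
move=> Tv v_free cardI a.
have free_enum : free (map v (enum I)).
  suff : free (map_tuple v (enum_tuple I)) by [].
  apply/freeP => k sk0 i.
  rewrite -(enum_valK i); apply: (v_free (k \o enum_rank)); rewrite -[RHS]sk0.
  rewrite (reindex _ (onW_bij _ (enum_val_bij I))) /=.
  apply: eq_bigr => j _; rewrite enum_valK (nth_map (enum_val j)) -?cardE //.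
  by rewrite -enum_val_nth.
have enum_filter : enum [set i | f i == a] = [seq i <- enum I | f i == a].
  by rewrite {1}/enum_mem -enumT; apply: eq_filter => i; exact: in_set.
have free_sub : free (map v (enum [set i | f i == a])).
  apply: (@catl_free _ _ (map v [seq i <- enum I | f i != a])).
  rewrite -map_cat enum_filter (perm_free (_ : perm_eq _ (map v (enum I)))) //.
  by rewrite perm_map // perm_filterC.
have full : <<map v (enum I)>>%VS = fullv.
  apply/eqP; rewrite eqEdim subvf (eqnP free_enum) size_map -cardE cardI.
  exact: leqnn.
have -> : passmx.leigenspace T a = <<map v (enum [set i | f i == a])>>%VS.
  apply/vspaceP => x; apply/idP/idP; last first.
    move: x; apply/subvP/span_subvP => _ /mapP[i + ->].
    rewrite mem_enum inE => /eqP fi; rewrite memv_ker.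
    by rewrite add_lfunE opp_lfunE scale_lfunE id_lfunE Tv fi subrr.
  have : x \in <<map v (enum I)>>%VS by rewrite full memvf.
  case/(free_span free_enum) => k xE _.
  rewrite big_map big_enum /= in xE.
  rewrite memv_ker add_lfunE opp_lfunE scale_lfunE id_lfunE xE => /eqP.
  rewrite linear_sum scaler_sumr -sumrB => h.
  have {}h : \sum_i (k (v i) * (f i - a)) *: v i = 0.
    rewrite -[RHS]h; apply: eq_bigr => i _.
    by rewrite linearZ /= Tv scalerA [in RHS]scalerA -scalerBl mulrBr [a * _]mulrC.
  apply: memv_suml => i _; have [fi|nfi] := eqVneq (f i) a.
    by apply/memvZ/memv_span/map_f; rewrite mem_enum inE fi.
  move/eqP: (v_free _ h i); rewrite mulf_eq0 subr_eq0 (negPf nfi) orbF.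
  by move=> /eqP->; rewrite scale0r mem0v.
by rewrite (eqnP free_sub) size_map -cardE.
Qed.

End Eigenbasis.

(** * Fock states over a vacuum *)

Section OccupationBasis.

Variables (K : fieldType) (vT : vectType K) (G : finType).
Variables (P F : G -> 'End(vT)) (Z : 'End(vT)) (v0 : vT).
Hypothesis nz2 : (2 : K) != 0.
Hypothesis FK : forall q v, F q (F q v) = v.
Hypothesis PF : forall q v, P q (F q v) = - F q (P q v).
Hypothesis PF_neq : forall p q v, p != q -> P p (F q v) = F q (P p v).
Hypothesis ZF : forall q v, Z (F q v) = - F q (Z v).
Hypothesis P0 : forall q, P q v0 = v0.
Hypothesis Z0 : Z v0 = v0.
Hypothesis nz0 : v0 != 0.

Definition occupied (S : {set G}) := foldr (fun q v => F q v) v0 (enum S).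

(** The enumeration of S has no repetition, so [P q] meets the flip of its own mode at most once and
    commutes past all others. *)
Lemma occupied_parity (S : {set G}) q :
  P q (occupied S) = (-1) ^+ (q \in S) *: occupied S.
Proof.
rewrite -mem_enum /occupied; have := enum_uniq S.
elim: (enum S) => [_|p l IHl /= /andP[npl ul]]; first by rewrite P0 scale1r.
rewrite in_cons; have [eqp|nqp] := eqVneq q p.
  by rewrite -eqp in npl *; rewrite PF IHl // (negPf npl) expr0 scale1r scaleN1r.
by rewrite PF_neq // IHl // linearZ.
Qed.

Lemma occupied_charge (S : {set G}) :
  Z (occupied S) = (-1) ^+ #|S| *: occupied S.
Proof.
rewrite cardE /occupied; elim: (enum S) => [|p l IHl] /=.
  by rewrite Z0 scale1r.
by rewrite ZF IHl linearZ exprS mulN1r scaleNr.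
Qed.

Lemma occupied_neq0 (S : {set G}) : occupied S != 0.
Proof.
rewrite /occupied; elim: (enum S) => //= p l; apply: contra_neq => h.
by rewrite -(FK p (foldr _ _ _)) h linear0.
Qed.

(** The parities take different sign patterns on different sets. The product of the operators
    [1 + sg q S *: P q] multiplies the state of S by a power of 2 and kills the state of every other
    set. *)
Lemma occupied_free (k : {set G} -> K) :
  \sum_S k S *: occupied S = 0 -> forall S, k S = 0.
Proof.
move=> k0 S; pose sg q (U : {set G}) : K := (-1) ^+ (q \in U).
pose pr l : 'End(vT) :=
  foldr (fun q T => ((\1 + sg q S *: P q) \o T)%VF) \1%VF l.
have prE l U : pr l (occupied U) =
    (\prod_(q <- l) (1 + sg q S * sg q U)) *: occupied U.
  elim: l => [|q l IHl] /=; first by rewrite big_nil scale1r id_lfunE.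
  rewrite comp_lfunE IHl linearZ /= add_lfunE scale_lfunE id_lfunE.
  rewrite occupied_parity scalerA -{1}[occupied U]scale1r -scalerDl scalerA.
  by rewrite big_cons mulrC.
have : pr (enum G) (\sum_U k U *: occupied U) = 0 by rewrite k0 linear0.
rewrite linear_sum (bigD1 S) //= big1 => [|U nUS]; last first.
  rewrite linearZ /= prE; have : ~~ [forall q, (q \in U) == (q \in S)].
    by apply: contra nUS => /forallP h; apply/eqP/setP => q; apply/eqP.
  rewrite negb_forall => /existsP[q nq].
  rewrite (big_rem q) ?mem_enum //= /sg; move: nq.
  by case: (q \in U); case: (q \in S) => //= _;
    rewrite ?(expr0, expr1, mul1r, mulr1) subrr mul0r scale0r scaler0.
rewrite addr0 linearZ /= prE scalerA => /eqP.
rewrite scaler_eq0 (negPf (occupied_neq0 S)) orbF mulf_eq0.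
case/orP => [/eqP//|]; rewrite prodf_seq_eq0 => /hasP[q _] /=.
by rewrite /sg; case: (q \in S); rewrite ?expr1 ?mulrNN mulr1 (negPf nz2).
Qed.

End OccupationBasis.

(** * Spectrum of a translation invariant Majorana chain *)

Section ChainSpectrum.

Variables (C : fieldType) (vT : vectType C) (G : finZmodType) (e : G -> G -> C).
Hypothesis eC : forall p q, e p q = e q p.
Hypothesis eD : forall p j k, e p (j + k) = e p j * e p k.
Hypothesis e_sum : forall p, \sum_j e p j = (p == 0)%:R * #|G|%:R.
Hypothesis nz2 : (2 : C) != 0.
Hypothesis nzG : (#|G|%:R : C) != 0.
Hypothesis no2 : forall q : G, q != 0 -> q + q != 0.
Hypothesis vT_proper : (0 < dim vT)%N.
Hypothesis dim_vT : \dim {:vT} = (2 ^ #|G|)%N.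

Local Notation E := (endo_alg vT_proper).

Variables (A B : G -> E) (Z : E).
Hypothesis AA : forall j k, anticomm (A j) (A k) ((j == k)%:R * 2).
Hypothesis BB : forall j k, anticomm (B j) (B k) ((j == k)%:R * -2).
Hypothesis AB : forall j k, anticomm (A j) (B k) 0.
Hypothesis ZA : forall j, anticomm Z (A j) 0.
Hypothesis ZB : forall j, anticomm Z (B j) 0.

Variable v0 : vT.
Hypothesis nz0 : v0 != 0.
Hypothesis vacuum : forall j, (A j + B j : 'End(vT)) v0 = 0.
Hypothesis Zv0 : (Z : 'End(vT)) v0 = v0.

Variables (s u : G -> C).
Hypothesis sN : forall q, s (- q) = s q.
Hypothesis u0 : u 0 = 1.
Hypothesis uN : forall q, u (- q) * u q = 1.

Let H : E := Z * (#|G|%:R^-1 *: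
  \sum_q (s q * u q) *: (fourier e B (- q) * fourier e A q)).

(** The gauge element r absorbs the phases u, so that [H * r = r * D] with D diagonal on the Fock
    states; their images under r form an eigenbasis of H. *)
Lemma chain_eigenspace_dim a :
  \dim (passmx.leigenspace (H : 'End(vT)) a) =
  #|[set S : {set G} |
      (-1) ^+ #|S| * \sum_q s q * (-1) ^+ (q \in S) == a]|.
Proof.
have [r [r' [r'r Zr br ar]]] := gauge eC eD e_sum nz2 nzG no2 AA AB ZA u0 uN.
pose f := annihilator e A B; pose g := creator e A B.
have ff := annihilator_anticomm eC eD e_sum AA BB AB.
have gg := creator_anticomm eC eD e_sum AA BB AB.
have fg := annihilator_creator eC eD e_sum nz2 nzG AA BB AB.
pose P q : E := mode_parity f g q; pose F q : E := mode_flip f g q.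
have mulE (x y : E) v :
  (x : 'End(vT)) ((y : 'End(vT)) v) = (x * y : E) v.
  by rewrite -comp_lfunE.
have FK q v : F q (F q v) = v.
  by rewrite mulE /F mode_flipK // id_lfunE.
have PF q v : P q (F q v) = - F q (P q v).
  by rewrite !mulE /P /F mode_parity_flip // opp_lfunE.
have PF_neq p q v : p != q -> P p (F q v) = F q (P p v).
  by move=> npq; rewrite !mulE /P /F mode_parity_flip_neq.
have ZF q v : Z (F q v) = - F q (Z v).
  rewrite !mulE (anticomm0E (Z_flip e ZA ZB q)) opp_lfunE //.
(* The annihilator is a Fourier sum of the local operators [A j + B j], each of which kills v0. *)
have f0 q : f q v0 = 0.
  rewrite /f /annihilator scale_lfunE add_lfunE !sum_lfunE -big_split /=.
  rewrite big1 ?scaler0 // => j _; rewrite !scale_lfunE -scalerDr.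
  by rewrite -add_lfunE vacuum scaler0.
have P0 q : P q v0 = v0.
  have -> : P q = 1 - g q * f q - g q * f q.
    by rewrite /P /mode_parity (anticommE (fg q q)) eqxx scale1r.
  by rewrite !add_lfunE !opp_lfunE -!mulE f0 linear0 oppr0 !addr0 id_lfunE.
pose w := occupied F v0.
pose D : E := Z * \sum_q s q *: P q.
have HR : H * r = r * D.
  rewrite /H /D sum_mode_parity // -[LHS]mulrA [RHS]mulrA -[r * Z]Zr -[RHS]mulrA; congr (Z * _).
  rewrite -scalerAl -scalerAr mulr_suml mulr_sumr; congr (_ *: _).
  apply: eq_bigr => q _; rewrite -scalerAl -scalerAr -scalerA; congr (_ *: _).
  by rewrite mulrA -br -!mulrA -ar scalerAr.
have Dw S : D (w S) =
    ((-1) ^+ #|S| * \sum_q s q * (-1) ^+ (q \in S)) *: w S.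
  rewrite -mulE sum_lfunE.
  have -> : \sum_q (s q *: P q : 'End(vT)) (w S) =
      (\sum_q s q * (-1) ^+ (q \in S)) *: w S.
    rewrite scaler_suml; apply: eq_bigr => q _.
    by rewrite scale_lfunE (occupied_parity PF PF_neq P0) scalerA.
  by rewrite linearZ /= (occupied_charge ZF Zv0) scalerA mulrC.
apply: (@eigenbasis_dim _ _ _ _ (fun S => r (w S))).
- by move=> S; rewrite mulE HR -mulE Dw linearZ.
(* The left inverse r' carries a linear relation among the [r (w S)] back to the Fock states. *)
- move=> k k0; apply: (occupied_free nz2 FK PF PF_neq P0 nz0).
  have := congr1 (r' : 'End(vT)) k0; rewrite linear0 linear_sum /= => rk0.
  rewrite -[RHS]rk0.
  by apply: eq_bigr => S _; rewrite linearZ /= mulE r'r id_lfunE.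
- by rewrite -cardsT -powersetT card_powerset cardsT dim_vT.
Qed.

End ChainSpectrum.

(** * Pauli strings indexed by binary vectors *)

Section PauliStrings.

Variables (R : realType) (N : nat).
Local Notation config := (spin_config N).
Implicit Types (u w s : config) (j k : 'I_N).

Definition flip j : config := [ffun k => (k == j)%:R].

(** The bicharacter (-1)^(w.s) of the group (Z/2)^N; configurations are added modulo 2 at each
    site. *)
Definition sign w s : R[i] := \prod_j (-1) ^+ (w j * s j)%N.

Lemma sign_ord2D (a b c : 'I_2) :
  (-1) ^+ (a * (b + c)%R)%N = (-1) ^+ (a * b)%N * (-1) ^+ (a * c)%N :> R[i].
Proof.
by case: a b c => [[|[|]] // ?] [[|[|]] // ?] [[|[|]] // ?];
  rewrite /= ?mul0n ?mul1n ?expr0 ?expr1 ?mul1r ?mulr1 ?mulrNN ?mulr1.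
Qed.

Lemma signC w s : sign w s = sign s w.
Proof. by apply: eq_bigr => j _; rewrite mulnC. Qed.

Lemma signDr w s u : sign w (s + u) = sign w s * sign w u.
Proof. by rewrite -big_split; apply: eq_bigr => j _; rewrite ffunE sign_ord2D. Qed.

Lemma signDl w u s : sign (w + u) s = sign w s * sign u s.
Proof. by rewrite !(signC _ s) signDr. Qed.

Lemma sign0r w : sign w 0 = 1.
Proof. by apply: big1 => j _; rewrite ffunE muln0. Qed.

Lemma sign0l s : sign 0 s = 1.
Proof. by rewrite signC sign0r. Qed.

Lemma sign_flip w j : sign w (flip j) = (-1) ^+ w j.
Proof.
rewrite /sign (bigD1 j) //= big1 => [|k /negPf nkj].
  by rewrite ffunE eqxx muln1 mulr1.
by rewrite ffunE nkj muln0.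
Qed.

Lemma config_addcc u : u + u = 0.
Proof.
by apply/ffunP => j; rewrite !ffunE; apply/val_inj; case: (u j) => [[|[|]]].
Qed.

Lemma config_oppr u : - u = u.
Proof. by apply/eqP; rewrite eq_sym -addr_eq0 config_addcc. Qed.

(** The string Z^w X^u: sigma^x on the support of u, followed by sigma^z on the support of w. Up to
    a scalar, composing strings amounts to adding the pairs (u, w). *)
Definition pauli_fun u w (psi : spin_space R N) : spin_space R N :=
  [ffun s => sign w s * psi (s + u)].

Fact pauli_fun_is_linear u w :
  linear (pauli_fun u w : spin_space R N -> spin_space R N).
Proof.
move=> a x y; apply/ffunP => s; rewrite !ffunE mulrDr; congr (_ + _).
by rewrite mulrCA.
Qed.

HB.instance Definition _ u w :=
  GRing.isLinear.Build R[i] (spin_space R N) (spin_space R N) *:%R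
    (pauli_fun u w) (pauli_fun_is_linear u w).

Definition pauli u w : 'End(spin_space R N) := linfun (pauli_fun u w).

Lemma pauliE u w psi s : pauli u w psi s = sign w s * psi (s + u).
Proof. by rewrite lfunE ffunE. Qed.

(** The sign comes from moving X^u past Z^w'. *)
Lemma pauliM u w u' w' :
  (pauli u w \o pauli u' w')%VF = sign w' u *: pauli (u + u') (w + w').
Proof.
apply/lfunP => psi; apply/ffunP => s.
rewrite comp_lfunE scale_lfunE ffunE !pauliE signDr signDl addrA.
rewrite -[_ *: _]/(_ * _); ring.
Qed.

Lemma pauli00 : pauli 0 0 = \1%VF.
Proof.
by apply/lfunP => psi; apply/ffunP => s; rewrite pauliE id_lfunE sign0l mul1r addr0.
Qed.

Lemma set_spin_id s j : set_spin s j (s j) = s.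
Proof. by apply/ffunP => k; rewrite ffunE; case: eqP => [->|]. Qed.

Lemma set_spin_flip s j b : b != s j -> set_spin s j b = s + flip j.
Proof.
move=> nb; apply/ffunP => k; rewrite !ffunE; case: eqP => [->|_].
  apply/val_inj; move: nb.
  by case: b (s j) => [[|[|]] // ?] [[|[|]] // ?].
by rewrite addr0.
Qed.

Lemma site_opE2 (A : 'M[R[i]]_2) j psi s :
  site_op A j psi s = A (s j) (s j) * psi s
    + A (s j) (s j + 1) * psi (s + flip j).
Proof.
rewrite site_opE ffunE (bigD1 (s j)) //= set_spin_id; congr (_ + _).
rewrite (bigD1 (s j + 1)) /=; last first.
  by case: (s j) => [[|[|]] // ?].
rewrite big1 ?addr0 => [|b].
  by rewrite set_spin_flip //; case: (s j) => [[|[|]] // ?].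
by case: b (s j) => [[|[|]] // ?] [[|[|]] // ?].
Qed.

Lemma site_x j : site_op (pauli_x R) j = pauli (flip j) 0.
Proof.
apply/lfunP => psi; apply/ffunP => s; rewrite site_opE2 pauliE sign0l !mxE.
by case: (s j) => [[|[|]] // ?]; rewrite /= mul0r add0r.
Qed.

Lemma site_z j : site_op (pauli_z R) j = pauli 0 (flip j).
Proof.
apply/lfunP => psi; apply/ffunP => s; rewrite site_opE2 pauliE addr0 signC.
rewrite sign_flip !mxE.
by case: (s j) => [[|[|]] // ?]; rewrite /= mul0r addr0.
Qed.

Lemma site_y j : site_op (pauli_y R) j = - 'i *: pauli (flip j) (flip j).
Proof.
apply/lfunP => psi; apply/ffunP => s; rewrite site_opE2 scale_lfunE ffunE.
rewrite pauliE signC sign_flip !mxE -[_ *: _]/(_ * _) mulrA.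
case: (s j) => [[|[|]] // ?]; rewrite /= mul0r add0r ?expr0 ?expr1 ?mulr1 //.
by rewrite mulrN1 opprK.
Qed.

Lemma big_pauli_z (I : Type) (l : seq I) (w : I -> config) :
  \big[@comp_lfun _ _ _ _/ \1%VF]_(i <- l) pauli 0 (w i)
    = pauli 0 (\sum_(i <- l) w i).
Proof.
elim: l => [|i l IHl]; first by rewrite !big_nil pauli00.
by rewrite !big_cons IHl pauliM sign0r scale1r addr0.
Qed.

End PauliStrings.

(** * Translation covariant Majoranas on an odd ring *)

Section CovariantMajoranas.

Variables (R : realType) (M : nat).
Hypothesis oddN : odd M.+1.
Local Notation N := M.+1.
Local Notation config := (spin_config N).
Local Notation V := (spin_space R N).
Implicit Types (j k : 'I_N).

Lemma val_ordB (x y : 'I_N) :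
  (x - y : 'I_N) = (if (y <= x)%N then x - y else x + N - y)%N :> nat.
Proof.
rewrite /= modnDmr; have := ltn_ord x; have := ltn_ord y => hy hx.
case: leqP => h; last by rewrite modn_small; lia.
by rewrite (_ : x + (N - y) = (x - y) + N)%N ?modnDr ?modn_small; lia.
Qed.

Lemma ordB_D (x y z : 'I_N) : x - (y + z) = (x - y) - z.
Proof. by rewrite opprD addrA. Qed.

Lemma site_shift_add j m : site_shift j m = j + inZp m.
Proof. by apply/val_inj; rewrite /= site_shiftE modnDmr. Qed.

(* On a ring of odd length exactly one of d and - d is odd for d != 0, so this
   set of sites is a regular tournament. *)
Definition tail j : config := [ffun k => ((k != j) && ~~ odd (k - j)%R)%:R].

Lemma tail_id j : tail j j = 0.
Proof. by rewrite ffunE eqxx. Qed.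

(** The displacements k - j and j - k add up to the odd number N, so exactly one of them is even. *)
Lemma tail_swap j k : j != k -> tail j k = 1 + tail k j.
Proof.
move=> njk; rewrite !ffunE eq_sym njk !andTb !val_ordB.
have : (j != k :> nat) by [].
have := ltn_ord j; have := ltn_ord k.
set x := odd _; set y := odd _ => hk hj njk'.
have -> : y = ~~ x by rewrite {}/x {}/y; case: ltngtP => ?; lia.
by apply/val_inj; case: x.
Qed.

Definition ones : config := [ffun=> 1].

Lemma sign_ones_flip j : sign R ones (flip j) = -1.
Proof. by rewrite sign_flip ffunE expr1. Qed.

Lemma sign_flip_flip j k : sign R (flip k) (flip j) = (-1) ^+ (j == k).
Proof. by rewrite sign_flip ffunE; case: (j == k). Qed.

Lemma dim_spin_space : dim V = (2 ^ N)%N.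
Proof. by rewrite /dim /= card_ffun !card_ord muln1. Qed.

Lemma spin_space_proper : (0 < dim V)%N.
Proof. by rewrite dim_spin_space expn_gt0. Qed.

Local Notation E := (endo_alg spin_space_proper).

(** These strings square to 1. The extra sigma^z at j in [majorana_b] makes the square -1, which
    keeps every coefficient real. *)
Definition majorana_a j : E := pauli R (flip j) (tail j).
Definition majorana_b j : E := pauli R (flip j) (tail j + flip j).
Definition z_parity : E := pauli R 0 ones.

Lemma pauli_mulE (u w u' w' : config) :
  (pauli R u w : E) * (pauli R u' w' : E)
    = sign R w' u *: (pauli R (u + u') (w + w') : E).
Proof. exact: pauliM. Qed.

Lemma pauli_anticomm0 (u w u' w' : config) :
  sign R w' u = - sign R w u' ->
  anticomm (pauli R u w : E) (pauli R u' w' : E) 0.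
Proof.
move=> h; apply: anticomm0P.
by rewrite !pauli_mulE h scaleNr [u' + u]addrC [w' + w]addrC.
Qed.

Lemma pauli_sqr (u w : config) :
  (pauli R u w : E) * (pauli R u w : E) = (sign R w u)%:A.
Proof. by rewrite pauli_mulE !config_addcc pauli00. Qed.

(** By [tail_swap], exactly one of the two sites lies in the tail of the other. *)
Lemma majorana_tail_anticomm j k : j != k ->
  sign R (tail k) (flip j) = - sign R (tail j) (flip k).
Proof.
move=> njk; rewrite !sign_flip (tail_swap njk).
by case: (tail k j) => [[|[|]] // ?]; rewrite /= ?expr0 ?expr1 ?opprK.
Qed.

Lemma majorana_aa j k :
  anticomm (majorana_a j) (majorana_a k) ((j == k)%:R * 2).
Proof.
have [<-|njk] := eqVneq j k.
  rewrite /anticomm pauli_sqr sign_flip tail_id expr0 mul1r -scalerDl //.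
by rewrite mul0r; apply: pauli_anticomm0; exact: majorana_tail_anticomm.
Qed.

Lemma majorana_bb j k :
  anticomm (majorana_b j) (majorana_b k) ((j == k)%:R * -2).
Proof.
have [<-|njk] := eqVneq j k.
  rewrite /anticomm pauli_sqr signDl sign_flip_flip eqxx sign_flip tail_id.
  by rewrite expr0 !mul1r -scalerDl; congr (_ *: _); ring.
rewrite mul0r; apply: pauli_anticomm0; rewrite !signDl !sign_flip_flip.
by rewrite eq_sym [k == j]eq_sym (negPf njk) !mulr1 majorana_tail_anticomm.
Qed.

Lemma majorana_ab j k : anticomm (majorana_a j) (majorana_b k) 0.
Proof.
apply: pauli_anticomm0; rewrite signDl sign_flip_flip.
have [<-|njk] := eqVneq j k; first by rewrite mulrN1.
by rewrite mulr1 majorana_tail_anticomm.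
Qed.

Lemma z_parity_a j : anticomm z_parity (majorana_a j) 0.
Proof. by apply: pauli_anticomm0; rewrite sign0r sign_ones_flip opprK. Qed.

Lemma z_parity_b j : anticomm z_parity (majorana_b j) 0.
Proof. by apply: pauli_anticomm0; rewrite sign0r sign_ones_flip opprK. Qed.

Definition spin_vacuum : V := [ffun s : config => (s == 0)%:R].

Lemma spin_vacuum_neq0 : spin_vacuum != 0.
Proof. by apply/eqP => /ffunP/(_ 0); rewrite !ffunE eqxx => /eqP; rewrite oner_eq0. Qed.

(** Both strings send the configuration 0 to [flip j], where the extra sigma^z of [majorana_b] gives
    the opposite sign. *)
Lemma majorana_vacuum j :
  (majorana_a j + majorana_b j : 'End(V)) spin_vacuum = 0.
Proof.
apply/ffunP => s; rewrite add_lfunE !ffunE !pauliE !ffunE signDl.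
case: eqP => [|_]; last by rewrite !mulr0 addr0.
move/eqP; rewrite addr_eq0 config_oppr => /eqP->.
by rewrite sign_flip_flip eqxx !mulr1 mulrN1 subrr.
Qed.

Lemma z_parity_vacuum : (z_parity : 'End(V)) spin_vacuum = spin_vacuum.
Proof.
apply/ffunP => s; rewrite pauliE addr0 ffunE.
by case: eqP => [->|_]; rewrite ?sign0r ?mulr1 ?mulr0.
Qed.

Lemma flipE j k : flip j k = (k == j)%:R :> 'I_2.
Proof. by rewrite ffunE. Qed.

Lemma eq_ord_shift j k : (k == j) = ((k - j)%R == 0 :> nat).
Proof. by rewrite -subr_eq0. Qed.

Lemma tailE j k :
  tail j k = (((k - j)%R != 0 :> nat) && ~~ odd (k - j)%R)%:R :> 'I_2.
Proof. by rewrite ffunE eq_ord_shift. Qed.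

Lemma natr_ord2 (a b : bool) : a%:R + b%:R = (a (+) b)%:R :> 'I_2.
Proof. by apply/val_inj; case: a; case: b. Qed.

Lemma configDE (u w : config) k : (u + w) k = u k + w k.
Proof. by rewrite ffunE. Qed.

Lemma onesE k : ones k = true%:R. Proof. by rewrite ffunE. Qed.

(** Measured from j, the tail of j covers 2, 4, ..., the tail of j + 1 covers 0 and 3, 5, ..., and
    the extra sigma^z sits at 1. Each sigma^z thus occurs once, and [z_parity] cancels them all. *)
Lemma xx_bond j : (1 < N)%N ->
  (site_op (pauli_x R) j \o site_op (pauli_x R) (site_shift j 1))%VF
  = z_parity * (majorana_b (j + inZp 1) * majorana_a j).
Proof.
move=> ltN; have val1 : (inZp 1 : 'I_N) = 1%N :> nat by rewrite /= modn_small.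
rewrite !site_x site_shift_add pauliM sign0l scale1r addr0.
rewrite /majorana_b /majorana_a pauli_mulE -scalerAr pauli_mulE sign0r.
have -> : sign R (tail j) (flip (j + inZp 1)) = 1.
  by rewrite sign_flip tailE (addrC j) addrK val1.
rewrite !scale1r add0r addrC; congr (pauli R _ _).
apply/ffunP => k; rewrite !configDE onesE !tailE flipE eq_ord_shift ordB_D.
rewrite (val_ordB (k - j)) val1; have := ltn_ord (k - j); set x : nat := (k - j)%R => ltx.
rewrite !natr_ord2 ffunE -[LHS]/(false%:R); congr (nat_of_bool _)%:R.
by case: ifP => ?; lia.
Qed.

Definition z_sites j n : config := \sum_(1 <= i < n.+1) flip (site_shift j i).

(** Since n < N the string does not wrap around, so no site is counted twice and lost modulo 2. *)
Lemma z_sitesE j k n : (n < N)%N ->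
  z_sites j n k = ((0 < ((k - j)%R : nat)) && (((k - j)%R : nat) <= n))%N%:R :> 'I_2.
Proof.
move=> ltn; rewrite /z_sites sum_ffunE; elim: n ltn => [|n IHn] ltn.
  by rewrite big_nil; case: ltngtP.
rewrite big_nat_recr // (IHn (ltnW ltn)) flipE site_shift_add eq_ord_shift.
rewrite ordB_D (val_ordB (k - j)) [inZp _ : nat]modn_small //; have := ltn_ord (k - j).
set x : nat := (k - j)%R => ltx.
by rewrite [LHS]natr_ord2; congr (nat_of_bool _)%:R; case: ifP => ?; lia.
Qed.

(** As n + 1 is odd, the tails of j and j + n + 1 agree at displacements 1 to n + 1 and are
    complementary beyond; at 0 the second tail cancels the extra sigma^z. Multiplying by [z_parity]
    leaves sigma^z exactly on displacements 0 to n + 1. *)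
Lemma yzy_bond j n : (n.+1 < N)%N -> ~~ odd n ->
  (site_op (pauli_y R) j \o z_string R n j
     \o site_op (pauli_y R) (site_shift j n.+1))%VF
  = z_parity * (majorana_b j * majorana_a (j + inZp n.+1)).
Proof.
move=> ltnN evn; have valn : (inZp n.+1 : 'I_N) = n.+1 :> nat.
  by rewrite /= modn_small.
have -> : z_string R n j = pauli R 0 (z_sites j n).
  by rewrite /z_string -big_pauli_z; apply: eq_bigr => i _; rewrite site_z.
rewrite !site_y site_shift_add -!comp_lfunZl -comp_lfunZr scalerA.
rewrite !pauliM -comp_lfunZl pauliM.
rewrite /majorana_b /majorana_a pauli_mulE -scalerAr pauli_mulE sign0r.
rewrite scale1r.
have sub0 : (j - (j + inZp n.+1))%R = (N - n.+1)%N :> nat.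
  by rewrite ordB_D val_ordB valn subrr /= add0n.
have -> : sign R (z_sites j n) (flip j) = 1.
  by rewrite sign_flip (z_sitesE _ _ (ltnW ltnN)) subrr.
have -> : sign R (flip (j + inZp n.+1)) (flip j + 0) = 1.
  rewrite addr0 sign_flip flipE eq_ord_shift sub0.
  by case: eqP => // h; exfalso; lia.
(* The displacement N - (n + 1) is even and nonzero, so j lies in this tail. The resulting -1
   matches the square of the factor - i of the two sigma^y. *)
have -> : sign R (tail (j + inZp n.+1)) (flip j) = - 1.
  by rewrite sign_flip tailE sub0 (_ : _ && _ = true) //; lia.
rewrite !scale1r addr0 add0r mulrNN -expr2 sqr_i; congr (_ *: pauli R _ _).
apply/ffunP => k; rewrite !configDE onesE !tailE !flipE !eq_ord_shift ordB_D.
rewrite (z_sitesE _ _ (ltnW ltnN)) (val_ordB (k - j)) valn.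
have := ltn_ord (k - j); set x : nat := (k - j)%R => ltx.
rewrite !natr_ord2; congr (nat_of_bool _)%:R.
by case: ifP => ?; lia.
Qed.

End CovariantMajoranas.

(** * Minimising the energy over sets of occupied modes *)

Section OddExcitations.

Variables (R : realFieldType) (G : finType) (s : G -> R) (q0 : G).
Hypothesis oddG : odd #|G|.
Hypothesis s_gt0 : forall q, 0 < s q.
Hypothesis s_min : forall q, s q0 <= s q.

Definition energy (S : {set G}) : R :=
  (-1) ^+ #|S| * \sum_q s q * (-1) ^+ (q \in S).

Definition ground_energy := 2 * s q0 - \sum_q s q.

(** Complementing reverses every sign in the sum and, [#|G|] being odd, the prefactor too. This
    reduces energies to sets of odd size. *)
Lemma energyC (S : {set G}) : energy (~: S) = energy S.
Proof.
have oddC : odd #|~: S| = ~~ odd #|S|.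
  by move: oddG; rewrite -(cardsC S) oddD; do 2 case: (odd _).
rewrite /energy -signr_odd oddC -(signr_odd _ #|S|) signrN mulNr -mulrN -sumrN.
congr (_ * _); apply: eq_bigr => q _; rewrite inE signrN mulrN opprK //.
Qed.

Lemma energy_odd (S : {set G}) : odd #|S| ->
  energy S = 2 * (\sum_(q in S) s q) - \sum_q s q.
Proof.
move=> oddS; rewrite /energy -signr_odd oddS expr1 mulN1r.
rewrite (bigID (mem S)) [\sum_q s q](bigID (mem S)) /=.
rewrite (eq_bigr (fun q => - s q)) => [|q ->]; last by rewrite mulrN1.
rewrite [X in - (_ + X)](eq_bigr s) => [|q /negPf->]; last by rewrite mulr1.
by rewrite sumrN; ring.
Qed.

Lemma odd_sum_ge (S : {set G}) : odd #|S| -> s q0 <= \sum_(q in S) s q.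
Proof.
move=> oddS; have [/set0Pn[q qS]|] := boolP (S != set0); last first.
  by rewrite negbK => /eqP S0; rewrite S0 cards0 in oddS.
rewrite (bigD1 q) //= ler_wpDr ?s_min // sumr_ge0 // => p _; exact/ltW.
Qed.

(** An odd set is nonempty, and a second element would add a positive term to a sum that is already
    at least [s q0]. *)
Lemma odd_sum_eq (S : {set G}) : odd #|S| ->
  (\sum_(q in S) s q == s q0) = (S \in [set [set q] | q in [pred q | s q == s q0]]).
Proof.
move=> oddS; apply/eqP/imsetP => [sumS|[q + ->]]; last first.
  by rewrite inE big_set1 => /eqP.
have /set0Pn[q qS] : S != set0.
  by apply: contraTneq oddS => ->; rewrite cards0.
have {}sumS : \sum_(p in S :\ q) s p = s q0 - s q.
  by rewrite -sumS (big_setD1 q qS) /=; ring.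
have S1 : S = [set q].
  apply/eqP; rewrite eq_sym eqEsubset sub1set qS; apply/subsetP => p pS.
  rewrite inE; apply/negPn/negP => npq.
  have : 0 < \sum_(p in S :\ q) s p.
    rewrite (bigD1 p) /=; last by rewrite !inE npq.
    by rewrite ltr_wpDr // sumr_ge0 // => r _; exact/ltW.
  by rewrite sumS subr_gt0 ltNge s_min.
exists q => //; rewrite inE; move: sumS; rewrite S1 setDv big_set0 => /eqP.
by rewrite eq_sym subr_eq0 eq_sym.
Qed.

Lemma ground_energy_le (S : {set G}) : ground_energy <= energy S.
Proof.
wlog oddS : S / odd #|S| => [hS|].
  have [/hS//|evS] := boolP (odd #|S|); rewrite -energyC; apply: hS.
  by move: oddG; rewrite -(cardsC S) oddD (negPf evS).
by rewrite energy_odd // lerD2r ler_pM2l // odd_sum_ge.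
Qed.

Lemma ground_energy_attained : energy [set q0] = ground_energy.
Proof. by rewrite energy_odd ?cards1 // big_set1. Qed.

(** The odd minimisers are the singletons of minimal s and the even ones their complements; the
    parity of the size separates the two families. *)
Lemma ground_energy_card :
  #|[set S | energy S == ground_energy]| = (2 * #|[set q | s q == s q0]|)%N.
Proof.
pose X := [set [set q] | q in [pred q | s q == s q0]].
have XE (S : {set G}) : odd #|S| -> (energy S == ground_energy) = (S \in X).
  move=> oddS; rewrite energy_odd // /ground_energy -odd_sum_eq //.
  by rewrite (inj_eq (addIr _)) (inj_eq (mulfI _)) // pnatr_eq0.
have oddX (S : {set G}) : S \in X -> odd #|S| by case/imsetP => q _ ->; rewrite cards1.
have -> : [set S | energy S == ground_energy] = X :|: (@setC G @: X).
  apply/setP => S; rewrite !inE; have [oddS|evS] := boolP (odd #|S|).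
    rewrite XE // orb_idr // => /imsetP[T /oddX oddT SE]; move: oddG.
    by rewrite -(cardsC T) oddD -SE oddT oddS.
  have oddC : odd #|~: S|.
    by move: oddG; rewrite -(cardsC S) oddD (negPf evS).
  rewrite -energyC XE // (contraNF (@oddX S) evS) /=.
  by rewrite -{2}(setCK S) (mem_imset _ _ (@setC_inj G)).
have cardX : #|X| = #|[set q | s q == s q0]|.
  by rewrite card_imset ?cardsE //; exact: set1_inj.
rewrite cardsU disjoint_setI0 ?cards0 ?subn0.
  by rewrite card_imset ?cardX ?mul2n ?addnn //; exact: setC_inj.
rewrite -setI_eq0; apply/set0Pn => -[S /setIP[/oddX oddS /imsetP[T /oddX oddT SE]]].
by move: oddG; rewrite -(cardsC T) oddD -SE oddT oddS.
Qed.

End OddExcitations.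

(** * Counting solutions of a linear congruence *)

Section MultiplesCount.

Lemma card_dvdn_ord d k : (0 < d)%N ->
  #|[set q : 'I_(k * d) | (d %| q)%N]| = k.
Proof.
move=> d0; have lt_kd (i : 'I_k) : (i * d < k * d)%N by rewrite ltn_pmul2r.
rewrite -[RHS]card_ord -cardsT -(card_imset (f := fun i => Ordinal (lt_kd i))).
  apply: eq_card => q; rewrite inE; apply/idP/imsetP => [/dvdnP[i qE]|[i _ ->]].
    have lti : (i < k)%N by rewrite -(ltn_pmul2r d0) -qE.
    by exists (Ordinal lti) => //; apply/val_inj.
  by rewrite /= dvdn_mull.
by move=> i j /(congr1 val) /= /eqP; rewrite eqn_pmul2r // => /eqP /val_inj.
Qed.

(** Dividing by g = gcd(N, m) leaves m / g coprime to N / g, so the condition becomes divisibility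
    of q by N / g. *)
Lemma card_dvdn_mulr N m : (0 < N)%N ->
  #|[set q : 'I_N | (N %| q * m)%N]| = gcdn N m.
Proof.
move=> N0; have g0 : (0 < gcdn N m)%N by rewrite gcdn_gt0 N0.
have NE : N = (gcdn N m * (N %/ gcdn N m))%N by rewrite mulnC divnK ?dvdn_gcdl.
have d0 : (0 < N %/ gcdn N m)%N by rewrite divn_gt0 // dvdn_leq // dvdn_gcdl.
have dvdE q : (N %| q * m)%N = (N %/ gcdn N m %| q)%N.
  have mE : m = (gcdn N m * (m %/ gcdn N m))%N by rewrite mulnC divnK ?dvdn_gcdr.
  have -> : (N %| q * m)%N =
      (gcdn N m * (N %/ gcdn N m) %| gcdn N m * (q * (m %/ gcdn N m)))%N.
    by rewrite -NE mulnCA -mE.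
  rewrite dvdn_pmul2l // Gauss_dvdl //.
  by rewrite /coprime -(eqn_pmul2l g0) muln_gcdr -NE -mE muln1.
(* The bound of the ordinals is abstracted as K so that its factorisation can be substituted in the
   type. *)
have cardK K : K = (gcdn N m * (N %/ gcdn N m))%N ->
  #|[set q : 'I_K | (N %/ gcdn N m %| q)%N]| = gcdn N m.
  by move->; apply: card_dvdn_ord.
by rewrite -[RHS](cardK N NE); apply: eq_card => q; rewrite !inE dvdE.
Qed.

End MultiplesCount.

(** X^n - 1 splits and, as n is nonzero in F, is separable; its n distinct roots include a primitive
    one. *)
Lemma prim_root_exists (F : closedFieldType) n : (n%:R : F) != 0 ->
  {w : F | n.-primitive_root w}.
Proof.
move=> nzn; have n_gt0 : (0 < n)%N by case: n nzn => //; rewrite eqxx.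
pose p : {poly F} := 'X^n - 1; have [r Dp] := closed_field_poly_normal p.
apply/sigW; rewrite (monicP _) ?monicXnsubC // scale1r in Dp.
have rn1 : all n.-unity_root r by apply/allP=> z; rewrite -root_prod_XsubC -Dp.
have sz_r : (n < (size r).+1)%N.
  by rewrite -(size_prod_XsubC r id) -Dp size_XnsubC.
have [|z] := hasP (has_prim_root n_gt0 rn1 _ sz_r); last by exists z.
by rewrite -separable_prod_XsubC -Dp separable_Xn_sub_1.
Qed.

(** * Symbol, modulus and phase of the Hamiltonian in momentum space *)

Section Dispersion.

Variables (R : realType) (M n : nat) (lambda : R) (w : R[i]).
Hypothesis oddN : odd M.+1.
Hypothesis evn : ~~ odd n.
Hypothesis ltnN : (n + 2 < M.+1)%N.
Hypothesis w_prim : M.+1.-primitive_root w.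
Hypothesis lambda_lt1 : `|lambda| < 1.
Local Notation N := M.+1.
Implicit Types (p q j k : 'I_N).

Definition character p q : R[i] := w ^+ (p * q)%N.
Local Notation e := character.

Lemma characterC p q : e p q = e q p.
Proof. by rewrite /e mulnC. Qed.

Lemma characterr0 p : e p 0 = 1.
Proof. by rewrite /e muln0. Qed.

Lemma characterD p j k : e p (j + k) = e p j * e p k.
Proof.
by rewrite /e -exprD -mulnDr -(prim_expr_mod w_prim) modnMmr prim_expr_mod.
Qed.

Lemma character_inZp p m : e p (inZp m) = w ^+ (p * m)%N.
Proof. by rewrite /e -(prim_expr_mod w_prim) modnMmr prim_expr_mod. Qed.

Lemma character_neq0 p q : e p q != 0.
Proof. by rewrite expf_neq0 // (prim_root_eq0 w_prim). Qed.

Lemma characterN p q : e p (- q) = (e p q)^-1.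
Proof.
apply: (mulfI (character_neq0 p q)); rewrite divff ?character_neq0 //.
by rewrite -characterD subrr characterr0.
Qed.

Lemma character_sum p : \sum_j e p j = (p == 0)%:R * #|'I_N|%:R.
Proof.
rewrite card_ord; have [->|np0] := eqVneq p 0.
  rewrite mul1r (eq_bigr (fun=> 1)) => [|j _]; last by rewrite characterC characterr0.
  by rewrite sumr_const card_ord.
rewrite mul0r; apply/eqP; have : (w ^+ p - 1) * \sum_j e p j = 0.
  rewrite (eq_bigr (fun j : 'I_N => (w ^+ p) ^+ j)) => [|j _]; last by rewrite /e exprM.
  by rewrite -subrX1 exprAC (prim_expr_order w_prim) expr1n subrr.
move/eqP; rewrite mulf_eq0 subr_eq0 => /orP[|//].
rewrite -(expr0 w) (eq_prim_root_expr w_prim) mod0n modn_small // => p0.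
by case/eqP: np0; apply/val_inj/eqP.
Qed.

Lemma conj_w : conjc w = w^-1.
Proof.
have w0 : w != 0 by rewrite (prim_root_eq0 w_prim).
have nw : `|w| = 1.
  apply/eqP; rewrite -(@pexpr_eq1 _ _ N) // -normrX.
  by rewrite (prim_expr_order w_prim) normr1.
by apply: (mulfI w0); rewrite divff // -sqr_normc nw expr1n.
Qed.

Lemma conj_character p q : conjc (e p q) = e p (- q).
Proof. by rewrite characterN /e rmorphXn /= conj_w exprVn. Qed.

(** The ratio of the two characters in [symbol]: the displacements -1 and n + 1 of the two bond
    terms differ by n + 2. *)
Definition phase q : R[i] := w ^+ (q * (n + 2))%N.

Lemma phase_character q : phase q = e q (inZp 1) * e q (inZp n.+1).
Proof. by rewrite !character_inZp -exprD -mulnDr add1n -addn2. Qed.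

Lemma phase_neq0 q : phase q != 0.
Proof. by rewrite phase_character mulf_neq0 ?character_neq0. Qed.

Lemma phaseB p q : phase (p - q) = phase p / phase q.
Proof.
rewrite !phase_character invfM mulrACA ![e (p - q) _]characterC !characterD.
by rewrite !characterN ![e (inZp _) _]characterC.
Qed.

Lemma conj_phase q : conjc (phase q) = (phase q)^-1.
Proof. by rewrite /phase rmorphXn /= conj_w exprVn. Qed.

Lemma phase_norm q : `|phase q| = 1.
Proof.
apply/eqP; rewrite -(@pexpr_eq1 _ _ 2) // sqr_normc conj_phase.
by rewrite divff ?phase_neq0.
Qed.

Lemma phase_Re_Im q :
  complex.Re (phase q) ^+ 2 + complex.Im (phase q) ^+ 2 = 1.
Proof. by apply: (@complexI R); rewrite add_Re2_Im2 phase_norm expr1n. Qed.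

Definition symbol q : R[i] :=
  e q (inZp 1) + lambda%:C * e q (- inZp n.+1).

Lemma symbolE q : symbol q = e q (inZp 1) * (1 + lambda%:C / phase q).
Proof.
rewrite /symbol mulrDr mulr1 phase_character invfM mulrCA; congr (_ + _ * _).
by rewrite mulrA divff ?character_neq0 // mul1r characterN.
Qed.

Lemma conj_symbol q : conjc (symbol q) = symbol (- q).
Proof.
rewrite /symbol rmorphD rmorphM.
rewrite -[LHS]/(conjc (e q _) + conjc lambda%:C * conjc (e q _)) conjc_real.
by rewrite !conj_character ![e (- q) _]characterC !characterN ![e _ q]characterC
  !characterN invrK.
Qed.

(** The modulus is an element of [R[i]]; its real part is taken to have a value in R that can be
    ordered. *)
Definition dispersion q : R := complex.Re `|symbol q|.

Lemma dispersionE q : (dispersion q)%:C = `|symbol q|.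
Proof. by rewrite RRe_real // normr_real. Qed.

Lemma dispersion_sqr q :
  dispersion q ^+ 2 = 1 + lambda ^+ 2 + 2 * lambda * complex.Re (phase q).
Proof.
have norm_e : `|e q (inZp 1)| = 1.
  apply/eqP; rewrite -(@pexpr_eq1 _ _ 2) // sqr_normc conj_character characterN.
  by rewrite divff ?character_neq0.
apply: (@complexI R); rewrite rmorphXn /= dispersionE symbolE normrM norm_e mul1r.
rewrite -conj_phase -add_Re2_Im2; congr (_ %:C).
have := phase_Re_Im q; case: (phase q) => x y /= xy1.
have -> : 1 + lambda ^+ 2 = 1 + lambda ^+ 2 * (x ^+ 2 + y ^+ 2).
  by rewrite xy1 mulr1.
ring.
Qed.

(** Since the real part of the phase lies in [-1, 1], the square is at least (1 - |lambda|)^2. *)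
Lemma dispersion_gt0 q : 0 < dispersion q.
Proof.
have ge0 : 0 <= dispersion q by rewrite -lecR dispersionE normr_ge0.
have Re1 : `|complex.Re (phase q)| <= 1.
  by rewrite -lecR (le_trans (normc_ge_Re _)) // phase_norm.
have : 0 < dispersion q ^+ 2.
  rewrite dispersion_sqr; move: lambda_lt1 Re1; rewrite ltr_norml ler_norml.
  set x := complex.Re _ => /andP[l1 l2] /andP[x1 x2].
  have [l0|l0] := leP 0 lambda.
    have : 0 <= lambda * (1 + x) by rewrite mulr_ge0 //; lra.
    have : 0 < (1 - lambda) ^+ 2 by rewrite exprn_gt0 //; lra.
    by nra.
  have : 0 <= (- lambda) * (1 - x) by rewrite mulr_ge0 //; lra.
  have : 0 < (1 + lambda) ^+ 2 by rewrite exprn_gt0 //; lra.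
  by nra.
by rewrite exprn_even_gt0 //= lt_def ge0 andbT.
Qed.

Lemma dispersionN q : dispersion (- q) = dispersion q.
Proof. by rewrite /dispersion -conj_symbol normcJ. Qed.

Definition direction q : R[i] := symbol q / (dispersion q)%:C.

Lemma direction0 : direction 0 = 1.
Proof.
have s0 : symbol 0 = (1 + lambda)%:C.
  rewrite /symbol !(characterC 0) !characterr0 mulr1 rmorphD rmorph1 //.
have pos : 0 <= 1 + lambda by move: lambda_lt1; rewrite ltr_norml; lra.
rewrite /direction dispersionE s0 ger0_norm ?lecR // divff //.
apply: contraTneq (dispersion_gt0 0) => /eqP; rewrite -s0 -normr_eq0.
by rewrite -dispersionE => /eqP/complexI->; rewrite ltxx.
Qed.

Lemma directionN q : direction (- q) * direction q = 1.
Proof.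
rewrite /direction dispersionN mulf_div -conj_symbol [conjc _ * _]mulrC.
rewrite -sqr_normc -dispersionE -expr2 divff // expf_neq0 // fmorph_eq0.
by rewrite gt_eqF // dispersion_gt0.
Qed.

Lemma dispersion_direction q : (dispersion q)%:C * direction q = symbol q.
Proof.
rewrite /direction mulrCA divff ?mulr1 // dispersionE normr_eq0.
by rewrite -normr_eq0 -dispersionE fmorph_eq0 gt_eqF // dispersion_gt0.
Qed.

Lemma cluster_isingE : cluster_ising N n lambda =
  z_parity R M * (#|'I_N|%:R^-1 *:
    \sum_q ((dispersion q)%:C * direction q) *:
      (fourier e (majorana_b R (M := M)) (- q) * fourier e (majorana_a R (M := M)) q)).
Proof.
rewrite /cluster_ising.
have nzN : #|'I_N|%:R != 0 :> R[i] by rewrite card_ord pnatr_eq0.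
have -> : \sum_q ((dispersion q)%:C * direction q) *:
      (fourier e (majorana_b R (M := M)) (- q) * fourier e (majorana_a R (M := M)) q) =
  #|'I_N|%:R *: (\sum_j majorana_b R j * majorana_a R (j - inZp 1) +
     lambda%:C *: \sum_j majorana_b R j * majorana_a R (j + inZp n.+1)).
  rewrite scalerDr scalerA mulrC -scalerA.
  rewrite -!(convolution_fourier characterr0 characterC characterD character_sum).
  rewrite scaler_sumr -big_split; apply: eq_bigr => q _ /=.
  by rewrite dispersion_direction /symbol opprK scalerDl scalerA.
rewrite scalerA mulVf // scale1r mulrDr -scalerAr !mulr_sumr; congr (_ + _ *: _).
  (* [xx_bond] carries its [majorana_b] at j + 1, so the sum is shifted by one site. *)
  rewrite [RHS](reindex_inj (addIr (inZp 1))); apply: eq_bigr => j _.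
  by rewrite addrK xx_bond //; lia.
by apply: eq_bigr => j _; rewrite yzy_bond //; lia.
Qed.

Lemma cluster_eigenspace_dim a :
  \dim (passmx.leigenspace (cluster_ising N n lambda) a) =
  #|[set S : {set 'I_N} | (energy dispersion S)%:C == a]|.
Proof.
rewrite cluster_isingE.
have nz2 : 2 != 0 :> R[i] by rewrite pnatr_eq0.
have nzN : #|'I_N|%:R != 0 :> R[i] by rewrite card_ord pnatr_eq0.
(* N is odd, so it divides 2 q only if it divides q. *)
have no2 q : q != 0 -> q + q != 0.
  apply: contra_neq => /(congr1 val) /= /eqP; rewrite addnn -muln2.
  rewrite -[_ == _]/(N %| _)%N Gauss_dvdl ?coprimen2 // => dvdq.
  apply/val_inj/eqP; move: dvdq; rewrite /dvdn modn_small //.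
have dimV : \dim {:spin_space R N} = (2 ^ #|'I_N|)%N.
  by rewrite dimvf dim_spin_space card_ord.
have sN q : (dispersion (- q))%:C = (dispersion q)%:C :> R[i].
  by rewrite dispersionN.
rewrite (chain_eigenspace_dim characterC characterD character_sum nz2 nzN no2
  dimV (@majorana_aa R M oddN) (@majorana_bb R M oddN) (@majorana_ab R M oddN)
  (@z_parity_a R M) (@z_parity_b R M) (@spin_vacuum_neq0 R M)
  (@majorana_vacuum R M) (@z_parity_vacuum R M) sN direction0 directionN).
apply: eq_card => S; rewrite !inE; congr (_ == a).
rewrite /energy rmorphM rmorph_sum rmorphXn rmorphN1; congr (_ * _).
by apply: eq_bigr => q _; rewrite rmorphM rmorphXn rmorphN1.
Qed.

End Dispersion.

(** * Minimisers of the dispersion and ground state degeneracy *)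

Section GroundState.

Variables (R : realType) (M n : nat) (lambda : R) (w : R[i]).
Hypothesis oddN : odd M.+1.
Hypothesis evn : ~~ odd n.
Hypothesis ltnN : (n + 2 < M.+1)%N.
Hypothesis w_prim : M.+1.-primitive_root w.
Hypothesis lambda_lt1 : `|lambda| < 1.
Local Notation N := M.+1.
Local Notation H := (cluster_ising N n lambda).
Local Notation phase := (@phase R M n w).
Local Notation dispersion := (@dispersion R M n lambda w).
Local Notation ReP q := (complex.Re (phase q)).
Implicit Types (p q : 'I_N).

Lemma phase0 : phase 0 = 1.
Proof. by rewrite /phase mul0n. Qed.

(** The phase is a homomorphism, so its fibres are translates of the kernel, the solutions of N | q
    (n + 2). *)
Lemma phase_count p : #|[set q | phase q == phase p]| = gcdn N (n + 2).
Proof.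
rewrite -(@card_dvdn_mulr N (n + 2)) //.
rewrite -[RHS](card_imset _ (addIr p)); apply: eq_card => q.
rewrite inE; apply/idP/imsetP => [pq|[r + ->]].
  exists (q - p); last by rewrite subrK.
  rewrite inE (prim_order_dvd w_prim) -[w ^+ _]/(phase (q - p)).
  by rewrite (phaseB n w_prim) (eqP pq) divff // (phase_neq0 n w_prim).
rewrite inE (prim_order_dvd w_prim) -[w ^+ _]/(phase r) => /eqP r1.
by rewrite -[r](addrK p) (phaseB n w_prim) in r1; apply/eqP/divr1_eq.
Qed.

Lemma dispersion_le p q :
  (dispersion p <= dispersion q) = (lambda * ReP p <= lambda * ReP q).
Proof.
have d0 r : dispersion r \is Num.nneg.
  by rewrite nnegrE ltW // (dispersion_gt0 n w_prim).
rewrite -(ler_pXn2r (n := 2) _ (d0 p) (d0 q)) //.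
by rewrite !(dispersion_sqr _ _ w_prim) lerD2l -!mulrA ler_pM2l.
Qed.

Lemma dispersion_eq p q : lambda != 0 ->
  (dispersion p == dispersion q) = (ReP p == ReP q).
Proof.
move=> l0; rewrite [LHS]eq_le !dispersion_le -eq_le.
by rewrite (inj_eq (mulfI l0)).
Qed.

(** Eigenspace dimensions count the sets of a given energy, so the eigenvalues are exactly the
    energies of sets, and all are real. *)
Lemma ground_eigenspace q0 : (forall q, dispersion q0 <= dispersion q) ->
  exists E : R, is_smallest_eigenvalue H E
    /\ \dim (passmx.leigenspace H E%:C)
       = (2 * #|[set q | dispersion q == dispersion q0]|)%N.
Proof.
move=> q0_min; have d_gt0 := dispersion_gt0 n w_prim lambda_lt1.
have oddI : odd #|'I_N| by rewrite card_ord.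
have dimE := cluster_eigenspace_dim oddN evn ltnN w_prim lambda_lt1.
have eigE a : passmx.leigenvalue H a = [exists S, (energy dispersion S)%:C == a].
  rewrite /passmx.leigenvalue -dimv_eq0 dimE cards_eq0.
  apply/set0Pn/existsP => -[S]; rewrite ?inE => h; exists S; by rewrite ?inE.
exists (ground_energy dispersion q0); split; last first.
  rewrite dimE -(ground_energy_card oddI d_gt0 q0_min); apply: eq_card => S.
  by rewrite !inE (inj_eq (@complexI R)).
split; first by rewrite eigE; apply/existsP; exists [set q0]; rewrite ground_energy_attained.
move=> z; rewrite eigE => /existsP[S /eqP<-].
by rewrite lecR ground_energy_le.
Qed.

Lemma phase_Re_eq1 q : (ReP q == 1) = (phase q == 1).
Proof.
have := phase_Re_Im n w_prim q; case: (phase q) => x y /= xy.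
apply/eqP/eqP => [x1|[] //]; move: xy; rewrite x1 expr1n => /eqP.
by rewrite -subr_eq0 addrC addKr sqrf_eq0 => /eqP->.
Qed.

Lemma phase_Re_le1 q : ReP q <= 1.
Proof.
have := phase_Re_Im n w_prim q; set x := complex.Re _; set y := complex.Im _.
by move=> xy; have := sqr_ge0 y; have := sqr_ge0 (x - 1); nra.
Qed.

(** For negative lambda the dispersion is least where the real part of the phase is largest, that is
    on the fibre over 1. *)
Lemma ground_neg : lambda < 0 -> exists E : R, is_smallest_eigenvalue H E
  /\ \dim (passmx.leigenspace H E%:C) = (2 * gcdn N (n + 2))%N.
Proof.
move=> l0; have [|E [hE dimE]] := @ground_eigenspace 0.
  by move=> q; rewrite dispersion_le phase0 ler_nM2l // phase_Re_le1.
exists E; split=> //; rewrite dimE -(phase_count 0); congr (2 * _)%N.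
apply: eq_card => q; rewrite !inE (dispersion_eq _ _ (ltr0_neq0 l0)) phase0.
by rewrite -[complex.Re 1]/(1 : R) phase_Re_eq1.
Qed.

(** Equality would force the square of the phase to be 1, and N being odd, the phase itself to be
    1. *)
Lemma phase_conj_neq q : ReP q != 1 -> phase q != phase (- q).
Proof.
apply: contraNneq => /(congr1 (fun z => z * phase q)) /=.
have -> : phase (- q) * phase q = 1.
  rewrite -[- q]add0r (phaseB n w_prim) phase0 mul1r mulVf //.
  exact: phase_neq0.
rewrite phase_Re_eq1 -expr2 /phase -exprM => /eqP.
rewrite -(prim_order_dvd w_prim) Gauss_dvdl ?coprimen2 //.
by rewrite (prim_order_dvd w_prim).
Qed.

(** A point of the unit circle is determined by its real part up to conjugation, which corresponds
    to negating q. *)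
Lemma phase_Re_eq p q :
  (ReP p == ReP q) = (phase p == phase q) || (phase p == phase (- q)).
Proof.
have -> : phase (- q) = conjc (phase q).
  by rewrite (conj_phase n w_prim) -[- q]add0r (phaseB n w_prim) phase0 mul1r.
have := phase_Re_Im n w_prim p; have := phase_Re_Im n w_prim q.
case: (phase p) => x y; case: (phase q) => a b /= ab xy.
apply/eqP/orP => [xa|[/eqP[]//|/eqP[]//]].
have : (y - b) * (y + b) = 0.
  have -> : (y - b) * (y + b) = (x ^+ 2 + y ^+ 2) - (a ^+ 2 + b ^+ 2).
    by rewrite xa; ring.
  by rewrite xy ab subrr.
move/eqP; rewrite mulf_eq0 subr_eq0 addr_eq0 xa => /orP[] /eqP->.
  by left.
by right.
Qed.

(** The minimisers form the fibres over a phase and its conjugate, distinct because the minimal real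
    part is not 1. Each fibre has g elements, and the complements of singletons double the count. *)
Lemma ground_pos : 0 < lambda -> exists E : R, is_smallest_eigenvalue H E
  /\ \dim (passmx.leigenspace H E%:C) = (4 * gcdn N (n + 2))%N.
Proof.
move=> l0; pose q0 := [arg min_(q < 0 : 'I_N) dispersion q]%O.
have q0_min q : dispersion q0 <= dispersion q.
  by rewrite /q0; case: arg_minP => // p _; apply.
have [E [hE dimE]] := ground_eigenspace q0_min.
exists E; split=> //; rewrite dimE.
(* Momentum 1 has phase w^(n+2), which is not 1 since 0 < n + 2 < N, so a real part equal to 1 is
   not minimal. *)
have Re_q0 : ReP q0 != 1.
  have := q0_min (inZp 1); rewrite dispersion_le ler_pM2l //.
  apply: contraTneq => ->; rewrite -ltNge lt_neqAle phase_Re_le1 andbT.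
  rewrite phase_Re_eq1 /phase -(prim_order_dvd w_prim) /= modn_small; last by lia.
  by rewrite mul1n gtnNdvd //; lia.
have -> : [set q | dispersion q == dispersion q0] =
    [set q | phase q == phase q0] :|: [set q | phase q == phase (- q0)].
  by apply/setP => q; rewrite !inE (dispersion_eq _ _ (lt0r_neq0 l0)) phase_Re_eq.
rewrite cardsU disjoint_setI0 ?cards0 ?subn0 ?phase_count.
  by rewrite addnn -mul2n mulnA.
rewrite -setI_eq0; apply/set0Pn => -[q /setIP[]]; rewrite !inE => /eqP->.
exact/negP/phase_conj_neq.
Qed.

End GroundState.

Theorem mainTheorem3 (R : realType) (n N : nat) (lambda : R) :
  ~~ odd n -> odd N -> (n + 2 < N)%N ->
  let g := gcdn N (n + 2) in
  let H := cluster_ising N n lambda in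
  (0 < lambda < 1 ->
     exists E : R, is_smallest_eigenvalue H E
       /\ \dim (passmx.leigenspace H E%:C) = (4 * g)%N)
  /\
  (-1 < lambda < 0 ->
     exists E : R, is_smallest_eigenvalue H E
       /\ \dim (passmx.leigenspace H E%:C) = (2 * g)%N).
Proof.
case: N => // M evn oddN ltnN g H; rewrite {}/g {}/H.
have nzN : M.+1%:R != 0 :> R[i] by rewrite pnatr_eq0.
have [w w_prim] := prim_root_exists nzN.
split=> /andP[l0 l1].
  by apply: (ground_pos oddN evn ltnN w_prim) => //; rewrite ltr_norml; lra.
by apply: (ground_neg oddN evn ltnN w_prim) => //; rewrite ltr_norml; lra.
Qed.
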